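(* Let $p=(p_i)_{i\in\mathbb{N}}$ be a probability distribution over $\mathbb{N}$, let $\hat p$ be the MLE of $p$ based on $n$ independent observations, and let $\delta\in(0,1)$. Define $$a=\frac{4}{3n}\log\frac{2(n+1)}{\delta}+\frac{\log n}{n},\qquad b=2\sqrt{\frac{\log(n+1)}{n}+\frac1n\log\frac2\delta}.$$ Then, with probability at least $1-\delta-81/n$, $$\|p-\hat p\|_\infty\le a+\frac{3b^2}{2}+b\sqrt a+\frac{3b\sqrt{\hat v^*}}{2},$$ where $\hat v^*=\sup_{i\in\mathbb{N}}\hat p_i(1-\hat p_i)$.
   Context: $\mathbb{N}=\{1,2,\dots\}$; the support of $p$ may be finite or infinite. For i.i.d. draws $X^n=(X_1,\dots,X_n)$ from $p$, $\hat p_i=c_i(X^n)/n$ where $c_i(X^n)$ is the number of appearances of symbol $i$. $\|p-\hat p\|_\infty=\sup_{i\in\mathbb{N}}|p_i-\hat p_i|$. $\log$ is the natural logarithm. *)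

(* Defs.v *)
From HB Require Import structures.
From mathcomp Require Import all_boot all_order all_algebra.
From mathcomp Require Import all_classical all_reals all_analysis.

Set Implicit Arguments.
Unset Strict Implicit.
Unset Printing Implicit Defensive.

Import Order.TTheory GRing.Theory Num.Theory.

Local Open Scope classical_set_scope.
Local Open Scope ring_scope.

(* The alphabet {1, 2, ...} is [nat], where k : nat stands for the symbol k+1;
   the numerical value of a symbol is never used. *)
Definition is_distribution (R : realType) (p : nat -> R) : Prop :=
  (forall i, 0 <= p i) /\ (\sum_(0 <= i <oo) (p i)%:E = 1)%E.

Definition mutually_independent d d' (T : measurableType d)
    (T' : measurableType d') (R : realType) (P : probability T R)
    (I : finType) (X : I -> {RV P >-> T'}) : Prop :=
  forall (J : {set I}) (A : I -> set T'),
    (forall j, j \in J -> measurable (A j)) ->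
    P (\bigcap_(j in [set` J]) (X j @^-1` A j)) =
    (\prod_(j in J) P (X j @^-1` A j))%E.

Definition iid_sample d (T : measurableType d) (R : realType)
    (P : probability T R) (p : nat -> R) (n : nat)
    (X : 'I_n -> {RV P >-> nat}) : Prop :=
  (forall (j : 'I_n) (i : nat), distribution P (X j) [set i] = (p i)%:E) /\
  mutually_independent X.

Definition occurrences (n : nat) (x : 'I_n -> nat) (i : nat) : nat :=
  #|[pred j : 'I_n | x j == i]|.

Definition mle (R : realType) (n : nat) (x : 'I_n -> nat) (i : nat) : R :=
  (occurrences x i)%:R / n%:R.

(* [sup] is the real-valued supremum, with default value 0 on unbounded sets;
   the sets below are bounded when the arguments take values in [0, 1]. *)
Definition linf_dist (R : realType) (p q : nat -> R) : R :=
  sup [set `|p i - q i| | i in [set: nat]].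

Definition vstar (R : realType) (q : nat -> R) : R :=
  sup [set q i * (1 - q i) | i in [set: nat]].

(* Main.v *)
Require Import Defs.
From HB Require Import structures.
From mathcomp Require Import all_boot all_order all_algebra.
From mathcomp Require Import all_classical all_reals all_analysis.
From mathcomp Require Import ring lra.

Set Implicit Arguments.
Unset Strict Implicit.
Unset Printing Implicit Defensive.

Import Order.TTheory GRing.Theory Num.Theory.

Local Open Scope classical_set_scope.
Local Open Scope ring_scope.

(** Write [L = ln (2 (n + 1) / delta)] and [l = L / n].  Merging the two
    logarithms under the root gives [b ^ 2 = 4 l], and [a >= 0], so the
    right-hand side is at least [6 l + 3 sqrt l sqrt vhat], with [vhat] the
    largest empirical variance.  Outside an event of probability at most
    [delta], this quantity bounds [|p_i - phat_i|] for all [i] at once.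

    The alphabet is infinite, so the union bound only closes if the failure
    probability of symbol [i] is summable in [i]; it is made at most
    [delta p_i] ([atypical_mass_le]), and the [p_i] sum to 1.  Two regimes are
    needed.
    - If [n p_i >= 1], a Bernstein inequality ([binomial_bernstein]) gives
      [|p_i - phat_i| <= 2 sqrt (v_i l) + l], with [v_i = p_i (1 - p_i)], up to
      probability [2 exp (- L) = delta / (n + 1) <= delta p_i].
    - If [n p_i < 1], the symbol appears more than [6 L] times with a
      probability that is linear in [p_i] and tiny ([binomial_rare_tail]);
      otherwise both [p_i] and [phat_i] are at most [6 l].

    In the first regime the unknown [v_i] has to be replaced by [vhat].  As
    [x (1 - x)] is 1-Lipschitz on [[0, 1]], [v_i] exceeds [vhat] by at most the
    deviation itself, and the resulting quadratic inequality in the deviation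
    is solved by the arithmetic-geometric mean inequality
    ([bernstein_empirical]).

    The number of occurrences of a symbol is binomial: independence gives the
    probability of each set of positions holding the symbol
    ([probability_occurrence_pattern]), so all tails are finite sums over sets
    of positions and moment generating functions are given by the binomial
    formula. *)

(** * Exponential moments of a Bernoulli variable *)

(** For [x <= 0] this follows from [exp x <= 1 / (1 - x)].  On [[0, 1]], the
    function [(1 + x + x ^ 2) exp (- x)] has derivative
    [x (1 - x) exp (- x) >= 0] and value 1 at 0. *)
Lemma expR_le_quadratic (R : realType) (x : R) :
  x <= 1 -> expR x <= 1 + x + x ^+ 2.
Proof.
move=> x1; have [x0|x0] := leP x 0.
  have := expR_ge1Dx (- x); have := expR_gt0 x; have := expRxMexpNx_1 x.
  move: (expR x) (expR (- x)) => u v uv u0 v1.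
  have ux : u * (1 - x) <= 1 by rewrite -[leRHS]uv ler_pM2l.
  have x1' : 0 < 1 - x by lra.
  rewrite -(ler_pM2r x1'); apply: (le_trans ux); nra.
pose h (y : R) := (1 + y + y ^+ 2) * expR (- y).
have dh (y : R) : is_derive y 1 h (y * (1 - y) * expR (- y)).
  apply: is_derive_eq.
  rewrite /GRing.scale /=; ring.
suff : h 0 <= h x.
  rewrite /h oppr0 expR0 expr0n /= !addr0 mulr1 expRN.
  by rewrite ler_pdivlMr ?expR_gt0 // mul1r.
apply: (@ger0_derive1_ndecr _ h 0 1) => //; last exact: ltW.
- move=> y; rewrite in_itv /= => /andP[y0 y1]; rewrite derive1E (@derive_val _ _ _ _ _ _ _ (dh y)).
  by rewrite !mulr_ge0 ?expR_ge0 ?subr_ge0 // ltW.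
- apply: derivable_within_continuous => y _; exact: (@ex_derive _ _ _ _ _ _ _ (dh y)).
Qed.

(** After centring, the linear terms of the quadratic bound on the exponential
    cancel and the quadratic ones add up to the variance.  Allowing [s] of both
    signs covers upper and lower tails together. *)
Lemma bernoulli_mgf_le (R : realType) (p s : R) :
  0 <= p <= 1 -> -1 <= s <= 1 ->
  1 - p + p * expR s <= expR (s * p + s ^+ 2 * (p * (1 - p))).
Proof.
move=> /andP[p0 p1] /andP[s0 s1].
rewrite expRD -ler_pdivrMl ?expR_gt0 // -expRN.
apply: (@le_trans _ _ (1 + s ^+ 2 * (p * (1 - p)))); last exact: expR_ge1Dx.
have h0 : expR (- (s * p)) <= 1 + - (s * p) + (- (s * p)) ^+ 2.
  have : 0 <= (1 + s) * p by apply: mulr_ge0 => //; lra.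
  by move=> ?; apply: expR_le_quadratic; lra.
have h1 : expR (s * (1 - p)) <= 1 + s * (1 - p) + (s * (1 - p)) ^+ 2.
  have : 0 <= (1 - s) * (1 - p) by apply: mulr_ge0 => //; lra.
  by move=> ?; apply: expR_le_quadratic; lra.
have e1 : expR (- (s * p)) * expR s = expR (s * (1 - p)).
  by rewrite -expRD; congr expR; ring.
rewrite mulrDr mulrCA e1.
move: (expR (- (s * p))) (expR (s * (1 - p))) h0 h1 => u v h0 h1.
have : u * (1 - p) <= (1 + - (s * p) + (- (s * p)) ^+ 2) * (1 - p).
  by apply: ler_wpM2r; rewrite // subr_ge0.
have : p * v <= p * (1 + s * (1 - p) + (s * (1 - p)) ^+ 2) by exact: ler_wpM2l.
lra.
Qed.

(** * Binomial tails *)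

(** The probability that a binomial variable with parameters [n] and [p]
    satisfies [Q], as a sum over the possible sets of successful trials: this is
    the form in which independence delivers it. *)
Definition binomial_mass (R : realType) (n : nat) (p : R) (Q : pred nat) : R :=
  \sum_(J : {set 'I_n} | Q #|J|) p ^+ #|J| * (1 - p) ^+ (n - #|J|).

Lemma binomial_mass_markov (R : realType) (n : nat) (p : R) (Q : pred nat)
    (f : nat -> R) :
  0 <= p <= 1 -> (forall k, 0 <= f k) -> (forall k, Q k -> 1 <= f k) ->
  binomial_mass n p Q <=
  \sum_(J : {set 'I_n}) p ^+ #|J| * (1 - p) ^+ (n - #|J|) * f #|J|.
Proof.
move=> /andP[p0 p1] f0 f1; rewrite /binomial_mass big_mkcond /=.
apply: ler_sum => J _.
have w0 : 0 <= p ^+ #|J| * (1 - p) ^+ (n - #|J|).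
  by rewrite mulr_ge0 ?exprn_ge0 ?subr_ge0.
by case: ifP => [/f1 ?|_]; [exact: ler_peMr | exact: mulr_ge0].
Qed.

Lemma prodr_if_mem (R : comPzRingType) (n : nat) (J : {set 'I_n}) (x y : R) :
  \prod_(i < n) (if i \in J then x else y) = x ^+ #|J| * y ^+ (n - #|J|).
Proof.
rewrite (bigID (mem J)) /=; congr (_ * _).
  by rewrite (eq_bigr (fun=> x)) ?prodr_const // => i ->.
rewrite (eq_bigr (fun=> y)) => [|i /negbTE -> //].
rewrite prodr_const; congr (_ ^+ _).
by rewrite -[X in (X - _)%N]card_ord -(cardC J) addKn; apply: eq_card.
Qed.

Lemma sum_powerset_pow (R : comPzRingType) (n : nat) (x y : R) :
  \sum_(J : {set 'I_n}) x ^+ #|J| * y ^+ (n - #|J|) = (x + y) ^+ n.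
Proof.
transitivity (\prod_(i < n) (x + y)); last by rewrite prodr_const card_ord.
by rewrite bigA_distr; apply: eq_bigr => J _; rewrite prodr_if_mem.
Qed.

Lemma binomial_mgf (R : realType) (n : nat) (p s : R) :
  \sum_(J : {set 'I_n}) p ^+ #|J| * (1 - p) ^+ (n - #|J|) * expR (s * #|J|%:R)
  = (1 - p + p * expR s) ^+ n.
Proof.
rewrite [RHS](_ : _ = (p * expR s + (1 - p)) ^+ n); last by rewrite addrC.
rewrite -sum_powerset_pow; apply: eq_bigr => J _.
by rewrite expRM_natr exprMn mulrAC.
Qed.

Lemma binomial_chernoff (R : realType) (n : nat) (p s c : R) (Q : pred nat) :
  0 <= p <= 1 -> -1 <= s <= 1 ->
  (forall k, Q k -> c <= s * (k%:R - n%:R * p)) ->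
  binomial_mass n p Q <= expR (n%:R * (s ^+ 2 * (p * (1 - p))) - c).
Proof.
move=> p01 s11 Qc.
pose f (k : nat) := expR (s * (k%:R - n%:R * p) - c).
apply: (le_trans (binomial_mass_markov n p01 (f := f) _ _)).
- by move=> k; exact: expR_ge0.
- by move=> k /Qc kc; rewrite /f -[leLHS]expR0 ler_expR subr_ge0.
under eq_bigr => J _.
  rewrite /f (_ : _ - c = s * #|J|%:R + (- (s * n%:R * p) - c)); last by ring.
  rewrite expRD mulrA.
  over.
rewrite -mulr_suml binomial_mgf.
have -> : n%:R * (s ^+ 2 * (p * (1 - p))) - c =
    n%:R * (s * p + s ^+ 2 * (p * (1 - p))) + (- (s * n%:R * p) - c) by ring.
rewrite [leRHS]expRD expRM_natl ler_pM2r ?expR_gt0 //.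
apply: lerXn2r; rewrite ?nnegrE ?expR_ge0 //; last exact: bernoulli_mgf_le.
case/andP: p01 => p0 p1.
by rewrite addr_ge0 ?subr_ge0 // mulr_ge0 ?expR_ge0.
Qed.

(** The choice of the Chernoff parameter: [sqrt (l / v)] minimises
    [l / s + s v], and truncating it at 1 costs the additional term [l]. *)
Lemma chernoff_slope (R : rcfType) (v l : R) : 0 <= v -> 0 < l ->
  exists2 s, 0 <= s <= 1 & l + s ^+ 2 * v <= s * (2 * Num.sqrt (v * l) + l).
Proof.
move=> v0 l0.
have g0 : 0 <= Num.sqrt (v * l) by exact: sqrtr_ge0.
have g2 : Num.sqrt (v * l) ^+ 2 = v * l by rewrite sqr_sqrtr // mulr_ge0 // ltW.
have [vl|lv] := leP v l.
  exists 1; first by rewrite ler01 lexx.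
  suff : v <= Num.sqrt (v * l) by lra.
  rewrite -(@ler_pXn2r _ 2) ?nnegrE // g2 expr2.
  by rewrite ler_wpM2l.
have v0' : 0 < v by exact: lt_trans lv.
(* This is [sqrt (l / v)], in terms of the root that the statement uses. *)
exists (Num.sqrt (v * l) / v).
  rewrite divr_ge0 //= ler_pdivrMr // mul1r -(@ler_pXn2r _ 2) ?nnegrE // g2 expr2.
  by rewrite ler_wpM2l // ltW.
have -> : (Num.sqrt (v * l) / v) ^+ 2 * v = l.
  by rewrite expr_div_n g2; field; rewrite gt_eqF.
have -> : Num.sqrt (v * l) / v * (2 * Num.sqrt (v * l) + l) =
    2 * (Num.sqrt (v * l) ^+ 2) / v + Num.sqrt (v * l) / v * l by ring.
rewrite g2 (_ : 2 * (v * l) / v = l + l); last by field; rewrite gt_eqF.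
by rewrite lerDl mulr_ge0 ?divr_ge0 // ltW.
Qed.

(** Both tails come from the Chernoff bound with the same parameter, up to
    sign. *)
Lemma binomial_bernstein (R : realType) (n : nat) (p l : R) :
  (0 < n)%N -> 0 <= p <= 1 -> 0 < l ->
  binomial_mass n p
    (fun k => 2 * Num.sqrt (p * (1 - p) * l) + l < `|p - k%:R / n%:R|)
  <= 2 * expR (- (n%:R * l)).
Proof.
move=> n0 p01 l0; set r := 2 * _ + l.
have N0 : 0 < n%:R :> R by rewrite ltr0n.
have v0 : 0 <= p * (1 - p) by case/andP: p01 => ? ?; rewrite mulr_ge0 ?subr_ge0.
have [s s01 sr] := chernoff_slope v0 l0.
have [s0 s1] := andP s01.
pose c := n%:R * (s ^+ 2 * (p * (1 - p))) + n%:R * l.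
(* The sign [e] selects the upper or the lower tail. *)
have tail (e : R) : e = 1 \/ e = -1 ->
  binomial_mass n p (fun k => r < e * (k%:R / n%:R - p)) <= expR (- (n%:R * l)).
  move=> e1; have e2 : e ^+ 2 = 1 by case: e1 => ->; rewrite ?sqrrN expr1n.
  have -> : - (n%:R * l) = n%:R * ((e * s) ^+ 2 * (p * (1 - p))) - c.
    by rewrite exprMn e2 /c; ring.
  apply: binomial_chernoff => //.
    by case: e1 => ->; rewrite ?mul1r ?mulN1r; lra.
  move=> k rk.
  have -> : e * s * (k%:R - n%:R * p) = n%:R * (s * (e * (k%:R / n%:R - p))).
    by field; rewrite gt_eqF.
  rewrite /c -mulrDr ler_pM2l // addrC; apply: (le_trans sr).
  by rewrite ler_wpM2l // ltW.
rewrite mulr_natl mulr2n.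
apply: le_trans (lerD (tail 1 (or_introl erefl)) (tail (-1) (or_intror erefl))).
rewrite /binomial_mass !(big_mkcond (fun J : {set _} => _ < _)) /= -big_split.
apply: ler_sum => J _ /=.
have w0 : 0 <= p ^+ #|J| * (1 - p) ^+ (n - #|J|).
  by case/andP: p01 => ? ?; rewrite mulr_ge0 ?exprn_ge0 ?subr_ge0.
rewrite mul1r mulN1r opprB.
case: ifPn => [|_]; last by rewrite addr_ge0 //; case: ifP.
rewrite lter_normr opprB => /orP[->|->]; first by rewrite lerDr; case: ifP.
by rewrite lerDl; case: ifP.
Qed.

(** Markov's inequality for [exp S - 1] instead of [exp S]: since this variable
    vanishes at [S = 0], its mean [(1 + p (e - 1)) ^ n - 1] is of order [n p], so
    the bound carries the factor [p] that makes it summable over symbols. *)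
Lemma binomial_rare_tail (R : realType) (n : nat) (p K : R) :
  0 <= p <= 1 -> n%:R * p <= 1 -> 0 < K ->
  binomial_mass n p (fun k => K < k%:R) <=
  p * (2 * n%:R * expR 2 / (expR K - 1)).
Proof.
move=> p01 np1 K0; have [p0 p1] := andP p01.
have e3 : expR 1 <= 3 :> R.
  by apply: le_trans (expR_le_quadratic (lexx 1)) _; rewrite expr1n; lra.
have e1 : 1 <= expR 1 :> R by rewrite -[leLHS]expR0 ler_expR.
have EK : 0 < expR K - 1 by rewrite subr_gt0 expR_gt1.
pose f (k : nat) : R := (expR k%:R - 1) / (expR K - 1).
apply: (le_trans (binomial_mass_markov n p01 (f := f) _ _)).
- move=> k; apply: divr_ge0; last exact: ltW.
  by rewrite subr_ge0 -[leLHS]expR0 ler_expR.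
- by move=> k /ltW Kk; rewrite ler_pdivlMr // mul1r lerB // ler_expR.
have -> : \sum_(J : {set 'I_n}) p ^+ #|J| * (1 - p) ^+ (n - #|J|) * f #|J| =
    ((1 - p + p * expR 1) ^+ n - 1) / (expR K - 1).
  have w1 : \sum_(J : {set 'I_n}) p ^+ #|J| * (1 - p) ^+ (n - #|J|) = 1.
    by rewrite sum_powerset_pow addrC subrK expr1n.
  rewrite -binomial_mgf -[X in (_ - X) / _]w1 -sumrB mulr_suml.
  by apply: eq_bigr => J _; rewrite /f mul1r; ring.
rewrite !mulrA ler_pM2r ?invr_gt0 //.
(* [y] dominates the logarithm of the moment generating function; it is at
   most 2 because [n p <= 1] and [e <= 3]. *)
pose y := n%:R * (p * (expR 1 - 1)).
have z0 : 0 <= p * (expR 1 - 1) by rewrite mulr_ge0 // subr_ge0.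
have y0 : 0 <= y by rewrite mulr_ge0.
have yle : y <= n%:R * p * 2 by rewrite /y mulrA ler_wpM2l ?mulr_ge0 //; lra.
have -> : 1 - p + p * expR 1 = 1 + p * (expR 1 - 1) by ring.
have pow_le : (1 + p * (expR 1 - 1)) ^+ n <= expR y.
  by rewrite /y expRM_natl lerXn2r ?nnegrE ?expR_ge0 ?addr_ge0 // expR_ge1Dx.
have ey : expR y - 1 <= y * expR y.
  have := expR_ge1Dx (- y).
  rewrite -(ler_pM2r (expR_gt0 y)) -expRD addNr expR0; lra.
have e2 : expR y <= expR 2 by rewrite ler_expR; lra.
have : y * expR y <= n%:R * p * 2 * expR 2 by rewrite ler_pM // expR_ge0.
lra.
Qed.

(** With [t] the deviation, [u = sqrt (l v')] and [s] the root in the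
    hypothesis, [p (1 - p) <= v' + t] gives [s ^ 2 <= u ^ 2 + l t].  The weights
    [t / 3] and [3 l], whose product is [l t], turn this into
    [2 s <= 2 u + t / 3 + 3 l]; absorbing [t / 3] on the left multiplies the rest
    by 3/2, which gives the constants 3 and 6. *)
Lemma bernstein_empirical (R : rcfType) (p q v' l : R) :
  0 <= p <= 1 -> 0 <= q <= 1 -> 0 <= l -> q * (1 - q) <= v' ->
  `|p - q| <= 2 * Num.sqrt (p * (1 - p) * l) + l ->
  `|p - q| <= 6 * l + 3 * (Num.sqrt l * Num.sqrt v').
Proof.
move=> /andP[p0 p1] /andP[q0 q1] l0 qv.
have v0 : 0 <= v' by apply: le_trans qv; rewrite mulr_ge0 // subr_ge0.
set t := `|p - q|; set s := Num.sqrt _ => ts.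
have t0 : 0 <= t := normr_ge0 _.
have vt : p * (1 - p) <= v' + t.
  apply: (@le_trans _ _ (q * (1 - q) + t)); last by rewrite lerD2r.
  have -> : p * (1 - p) = q * (1 - q) + (p - q) * (1 - p - q) by ring.
  rewrite lerD2l (le_trans (ler_norm _)) // normrM ler_piMr // ler_norml.
  by apply/andP; split; lra.
rewrite -sqrtrM //; set u := Num.sqrt (l * v').
have u0 : 0 <= u := sqrtr_ge0 _.
have u2 : u ^+ 2 = l * v' by rewrite sqr_sqrtr // mulr_ge0.
have s0 : 0 <= s := sqrtr_ge0 _.
have s2 : s ^+ 2 = p * (1 - p) * l by rewrite sqr_sqrtr // !mulr_ge0 // subr_ge0.
have : 2 * s <= 2 * u + (t / 3 + 3 * l).
  rewrite -(@ler_pXn2r _ 2) ?nnegrE //; last 2 first.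
  - by rewrite mulr_ge0.
  - by rewrite !addr_ge0 ?mulr_ge0 // divr_ge0.
  have : p * (1 - p) * l <= (v' + t) * l by exact: ler_wpM2r.
  have : 0 <= u * (t / 3 + 3 * l) by rewrite mulr_ge0 // addr_ge0 ?mulr_ge0 ?divr_ge0.
  have := sqr_ge0 (t / 3 - 3 * l).
  lra.
lra.
Qed.

(** * The law of the number of occurrences *)

(** A sample takes countably many values, so every condition on it is a
    countable union of cylinders. *)
Lemma measurable_sample_event (R : realType) d (T : measurableType d)
    (P : probability T R) (n : nat) (X : 'I_n -> {RV P >-> nat})
    (S : set ('I_n -> nat)) :
  measurable [set w | S (fun j => X j w)].
Proof.
pose F (x : {ffun 'I_n -> nat}) : set T :=
  [set w | S x /\ forall j, X j w = x j].
have -> : [set w | S (fun j => X j w)] = \bigcup_x F x.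
  apply/seteqP; split => [w Sw|w [x _ [Sx Xx]]] /=; last first.
    by have -> : (fun j => X j w) = x by exact/funext.
  exists [ffun j => X j w] => //; split => [|j]; last by rewrite ffunE.
  have -> // : [ffun j => X j w] = (fun j => X j w) :> (_ -> _).
  by apply/funext => j; rewrite ffunE.
apply: countable_bigcupT_measurable => // x.
have [Sx|nSx] := pselect (S x); last first.
  by rewrite (_ : F x = set0) //; apply/seteqP; split => [w []|].
have -> : F x = \bigcap_(j in [set: 'I_n]) (X j @^-1` [set x j]).
  by apply/seteqP; split => [w [_ Xw] j _|w Xw] //=; split => // j; exact: Xw.
by apply: fin_bigcap_measurable => // j _; exact: measurable_funPTI.
Qed.

Lemma probability_occurrence_pattern (R : realType) d (T : measurableType d)
    (P : probability T R) (p : nat -> R) (n : nat) (X : 'I_n -> {RV P >-> nat})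
    (i : nat) (J : {set 'I_n}) :
  iid_sample p X ->
  P [set w | [set j | X j w == i]%SET = J] =
  (p i ^+ #|J| * (1 - p i) ^+ (n - #|J|))%:E.
Proof.
move=> [Xp Xind].
pose A (j : 'I_n) : set nat := if j \in J then [set i] else ~` [set i].
have -> : [set w | [set j | X j w == i]%SET = J] =
    \bigcap_(j in [set` [set: 'I_n]%SET]) (X j @^-1` A j).
  apply/seteqP; split => w /=.
    by move=> JE j _; rewrite /A -JE /= inE; case: eqP.
  move=> XA; apply/setP => j; rewrite inE.
  have := XA j; rewrite /= inE /A => /(_ isT).
  by case: ifP => _ /= => [->|/eqP/negbTE]; rewrite ?eqxx.
have PA j : P (X j @^-1` A j) = (if j \in J then p i else 1 - p i)%:E.
  have Pi := Xp j i; rewrite /distribution /pushforward /= in Pi.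
  rewrite /A; case: ifP => // _.
  rewrite -preimage_setC probability_setC; last exact: measurable_funPTI.
  by rewrite [X in (1 - X)%E]Pi EFinB.
rewrite Xind // (eq_bigr _ (fun j _ => PA j)) prodEFin -prodr_if_mem.
by congr EFin; apply: eq_bigl => j; rewrite inE.
Qed.

Lemma occurrences_binomial (R : realType) d (T : measurableType d)
    (P : probability T R) (p : nat -> R) (n : nat) (X : 'I_n -> {RV P >-> nat})
    (i : nat) (Q : pred nat) :
  iid_sample p X ->
  P [set w | Q (occurrences (fun j => X j w) i)] = (binomial_mass n (p i) Q)%:E.
Proof.
move=> Xiid.
pose E (J : {set 'I_n}) := [set w | [set j | X j w == i]%SET = J].
have -> : [set w | Q (occurrences (fun j => X j w) i)] =
    \bigcup_(J in [set J : {set 'I_n} | Q #|J|]) E J.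
  have occE w : occurrences (fun j => X j w) i = #|[set j | X j w == i]%SET|.
    by apply: eq_card => j; rewrite unfold_in /= ?inE.
  apply/seteqP; split => w /=; rewrite occE; last first.
    by move=> [J QJ]; rewrite /E /= => ->.
  by move=> QJ; exists [set j | X j w == i]%SET.
have finQ : finite_set [set J : {set 'I_n} | Q #|J|] by exact: finite_finset.
rewrite (measure_fin_bigcup P finQ); last 2 first.
- by move=> J K _ _ [w []]; rewrite /E /= => -> ->.
- move=> J _; rewrite /E.
  exact: (measurable_sample_event X (fun x => [set j | x j == i]%SET = J)).
rewrite -(@bigfs _ _ _ _ (index_enum {set 'I_n}) (fun J => Q #|J|)); last 2 first.
- exact: index_enum_uniq.
- by move=> J _; rewrite mem_index_enum.
rewrite /binomial_mass -sumEFin; apply: eq_bigr => J _.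
exact: probability_occurrence_pattern.
Qed.

(** * The deviation event *)

(** Since [p] sums to 1, failure probabilities proportional to [p i] make the
    union bound finite over the infinite alphabet. *)
Lemma deviation_union_bound (R : realType) d (T : measurableType d)
    (P : probability T R) (p : nat -> R) (n : nat) (X : 'I_n -> {RV P >-> nat})
    (delta : R) (bad : nat -> pred nat) :
  is_distribution p -> iid_sample p X -> 0 <= delta ->
  (forall i, binomial_mass n (p i) (bad i) <= delta * p i) ->
  ((1 - delta)%:E <=
   P [set w | forall i, ~~ bad i (occurrences (fun j => X j w) i)])%E.
Proof.
move=> [p0 p1] Xiid delta0 bad_le.
pose B i := [set w | bad i (occurrences (fun j => X j w) i)].
have mB i : measurable (B i).
  exact: (measurable_sample_event X (fun x => bad i (occurrences x i))).
have -> : [set w | forall i, ~~ bad i (occurrences (fun j => X j w) i)] =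
    ~` \bigcup_i B i.
  apply/seteqP; split => w /=.
    by move=> nb [i _]; rewrite /B /= => b; move: (nb i); rewrite b.
  by move=> nb i; apply/negP => b; apply: nb; exists i.
have mU : measurable (\bigcup_i B i) by exact: bigcupT_measurable.
rewrite probability_setC // EFinB leeB //.
apply: le_trans (generalized_Boole_inequality P mB mU) _.
apply: (@le_trans _ _ (\sum_(0 <= i <oo) (delta%:E * (p i)%:E))%E).
  apply: lee_nneseries => [i _ _|i _]; first exact: measure_ge0.
  by rewrite [leLHS](occurrences_binomial i (bad i) Xiid) -EFinM lee_fin.
by rewrite nneseriesZl ?p1 ?mule1 // => i _; rewrite lee_fin.
Qed.

(** The counts excluded for a symbol of probability [q]: Bernstein deviations
    for a frequent symbol, large counts for one expected less than once. *)
Definition atypical (R : realType) (n : nat) (L q : R) : pred nat :=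
  fun k => if 1 <= n%:R * q
           then 2 * Num.sqrt (q * (1 - q) * (L / n%:R)) + L / n%:R
                < `|q - k%:R / n%:R|
           else 6 * L < k%:R.

(** With [M = exp L], so that [delta M = 2 (n + 1)]: a frequent symbol fails with
    probability at most [2 / M = delta / (n + 1)], and [1 <= n q].  A rare one
    fails with probability at most [2 n e ^ 2 q / (M ^ 6 - 1)], where
    [e ^ 2 <= M ^ 2] and [M >= 4] leave ample room. *)
Lemma atypical_mass_le (R : realType) (n : nat) (q delta : R) :
  (0 < n)%N -> 0 <= q <= 1 -> 0 < delta < 1 ->
  binomial_mass n q (atypical n (ln (2 * (n%:R + 1) / delta)) q) <= delta * q.
Proof.
move=> n0 q01 /andP[d0 d1]; have [q0 q1] := andP q01.
set M := 2 * (n%:R + 1) / delta; set L := ln M.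
have N1 : 1 <= n%:R :> R by rewrite ler1n.
have N0 : 0 < n%:R :> R by rewrite ltr0n.
have dM : delta * M = 2 * (n%:R + 1) by rewrite /M; field; rewrite gt_eqF.
have M4 : 4 <= M.
  rewrite /M ler_pdivlMr //; lra.
have M0 : 0 < M by lra.
have eL : expR L = M by rewrite /L lnK // posrE.
have L0 : 0 < L by rewrite ln_gt0 //; lra.
have [nq|nq] := leP 1 (n%:R * q).
  rewrite (_ : atypical n L q = fun k => 2 * Num.sqrt (q * (1 - q) * (L / n%:R))
      + L / n%:R < `|q - k%:R / n%:R|); last by rewrite /atypical nq.
  apply: (le_trans (binomial_bernstein n0 q01 _)); first by rewrite divr_gt0.
  rewrite (_ : n%:R * (L / n%:R) = L); last by field; rewrite gt_eqF.
  rewrite expRN eL ler_pdivrMr // mulrAC dM.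
  lra.
rewrite (_ : atypical n L q = fun k => 6 * L < k%:R); last first.
  by rewrite /atypical leNgt nq.
apply: (le_trans (binomial_rare_tail q01 (ltW nq) _)); first by rewrite mulr_gt0.
rewrite mulrC ler_wpM2r //.
have -> : expR (6 * L) = M ^+ 6 by rewrite expRM_natl eL.
have e2 : expR 2 <= M ^+ 2.
  rewrite -[X in expR X]mulr1 expRM_natl lerXn2r ?nnegrE ?expR_ge0 ?(ltW M0) //.
  apply: le_trans (expR_le_quadratic (lexx 1)) _; rewrite expr1n; lra.
have M3 : 4 <= M ^+ 3.
  have : 4 ^+ 3 <= M ^+ 3 by rewrite lerXn2r ?nnegrE // ltW.
  lra.
have M2 : 1 <= M ^+ 2 by rewrite exprn_ege1 //; lra.
have dM6 : delta * M ^+ 6 = 2 * (n%:R + 1) * (M ^+ 2 * M ^+ 3) by rewrite -dM; ring.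
have M6 : 0 < M ^+ 6 - 1.
  rewrite subr_gt0 exprn_egt1 //; lra.
rewrite ler_pdivrMr // mulrBr mulr1 dM6.
have h1 : 2 * n%:R * expR 2 <= 2 * n%:R * M ^+ 2 by rewrite ler_wpM2l // mulr_ge0.
have h2 : 2 * (n%:R + 1) * (M ^+ 2 * 4) <= 2 * (n%:R + 1) * (M ^+ 2 * M ^+ 3).
  by rewrite ler_wpM2l ?mulr_ge0 ?addr_ge0 // ler_wpM2l //; lra.
have h3 : 0 <= n%:R * (M ^+ 2) by rewrite mulr_ge0 //; lra.
lra.
Qed.

Lemma mle_in01 (R : realType) (n : nat) (x : 'I_n -> nat) (i : nat) :
  (0 < n)%N -> 0 <= mle R x i <= 1.
Proof.
move=> n0; rewrite /mle divr_ge0 //= ler_pdivrMr ?ltr0n // mul1r ler_nat.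
by rewrite -[X in (_ <= X)%N]card_ord max_card.
Qed.

Lemma vstar_ge (R : realType) (q : nat -> R) (i : nat) :
  (forall j, 0 <= q j <= 1) -> q i * (1 - q i) <= vstar q.
Proof.
move=> q01; apply: ub_le_sup; last by exists i.
exists 1 => _ [j _ <-]; have /andP[q0 q1] := q01 j.
by rewrite -[leRHS]mulr1 ler_pM ?subr_ge0 // gerBl.
Qed.

(** For a rare symbol, [p i < 1 / n <= L / n], and a count of at most [6 L] puts
    the frequency within [6 L / n]; a frequent one falls under the empirical form
    of Bernstein's inequality. *)
Lemma typical_deviation (R : realType) (n : nat) (L : R) (p : nat -> R)
    (x : 'I_n -> nat) (i : nat) :
  (0 < n)%N -> 0 <= p i <= 1 -> 1 <= L ->
  ~~ atypical n L (p i) (occurrences x i) ->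
  `|p i - mle R x i| <=
  6 * (L / n%:R) + 3 * (Num.sqrt (L / n%:R) * Num.sqrt (vstar (mle R x))).
Proof.
move=> n0 p01 L1; have [p0 p1] := andP p01.
have N0 : 0 < n%:R :> R by rewrite ltr0n.
have l0 : 0 <= L / n%:R by rewrite divr_ge0 //; lra.
have x01 j := mle_in01 R x j n0; have /andP[x0 x1] := x01 i.
rewrite /atypical; have [np|np] := leP 1 (n%:R * p i); rewrite -leNgt => h.
  exact: (bernstein_empirical p01 (x01 i) l0 (vstar_ge i x01)).
have h1 : p i <= L / n%:R.
  by rewrite ler_pdivlMr // mulrC; lra.
have h2 : mle R x i <= 6 * (L / n%:R) by rewrite /mle mulrA ler_pM2r ?invr_gt0.
have h3 : 0 <= 3 * (Num.sqrt (L / n%:R) * Num.sqrt (vstar (mle R x))).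
  by rewrite !mulr_ge0.
by rewrite ler_norml; apply/andP; split; lra.
Qed.

Lemma distribution_in01 (R : realType) (p : nat -> R) (i : nat) :
  is_distribution p -> 0 <= p i <= 1.
Proof.
move=> [p0 p1]; rewrite p0 /= -lee_fin -p1.
rewrite (@nneseriesD1 _ _ i) // => [|j _]; last by rewrite lee_fin.
by rewrite leeDl // nneseries_ge0 // => j _ _; rewrite lee_fin.
Qed.

Theorem theorem4 (R : realType) (p : nat -> R) (hp : is_distribution p)
    (n : nat) (hn : (0 < n)%N) (delta : R) (hdelta : 0 < delta < 1)
    (d : measure_display) (T : measurableType d) (P : probability T R)
    (X : 'I_n -> {RV P >-> nat}) (hX : iid_sample p X) :
  let a : R := 4 / (3 * n%:R) * ln (2 * (n%:R + 1) / delta)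
               + ln n%:R / n%:R in
  let b : R := 2 * Num.sqrt (ln (n%:R + 1) / n%:R
                             + 1 / n%:R * ln (2 / delta)) in
  let phat (w : T) : nat -> R := mle R (fun j : 'I_n => X j w) in
  let good : set T :=
    [set w | linf_dist p (phat w)
             <= a + 3 * b ^+ 2 / 2 + b * Num.sqrt a
                + 3 * b * Num.sqrt (vstar (phat w)) / 2] in
  ((1 - delta - 81 / n%:R)%:E <= P good)%E.
Proof.
(* The local definitions sit inside a boolean, hence the explicit unfolding. *)
cbv zeta; set a := _ + ln n%:R / n%:R; set b := 2 * Num.sqrt (_ + _).
set good := (X in P X).
have [d0 d1] := andP hdelta.
have N0 : 0 < n%:R :> R by rewrite ltr0n.
have N1 : 1 <= n%:R :> R by rewrite ler1n.
set M := 2 * (n%:R + 1) / delta; pose L := ln M.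
have M4 : 4 <= M by rewrite /M ler_pdivlMr //; lra.
have L1 : 1 <= L.
  rewrite -[leLHS]expRK ler_ln ?posrE ?expR_gt0 //; last by lra.
  apply: le_trans (expR_le_quadratic (lexx 1)) _; rewrite expr1n; lra.
have l0 : 0 <= L / n%:R by rewrite divr_ge0 //; lra.
have bE : b = 2 * Num.sqrt (L / n%:R).
  rewrite /b mul1r mulrC [_^-1 * _]mulrC -mulrDl -lnM ?posrE ?divr_gt0 ?addr_gt0 //.
  by rewrite mulrC /L /M mulrA [_ * 2]mulrC.
have b0 : 0 <= b by rewrite bE mulr_ge0.
have b2 : b ^+ 2 = 4 * (L / n%:R).
  by rewrite bE exprMn sqr_sqrtr //; ring.
have a0 : 0 <= a.
  rewrite /a; apply: addr_ge0; last by rewrite divr_ge0 ?ln_ge0.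
  by rewrite mulr_ge0 ?divr_ge0 ?mulr_ge0 // ln_ge0 // -/M; lra.
apply: (@le_trans _ _ (1 - delta)%:E).
  by rewrite lee_fin gerBl divr_ge0.
have bad_le i := atypical_mass_le hn (distribution_in01 i hp) hdelta.
apply: (le_trans (deviation_union_bound hp hX (ltW d0) bad_le)).
apply: le_measure; rewrite ?inE.
- exact: (measurable_sample_event X
    (fun x => forall i, ~~ atypical n L (p i) (occurrences x i))).
- exact: (measurable_sample_event X (fun x => linf_dist p (mle R x) <=
    a + 3 * b ^+ 2 / 2 + b * Num.sqrt a + 3 * b * Num.sqrt (vstar (mle R x)) / 2)).
move=> w typ; rewrite /good /=.
apply: ge_sup; first by exists `|p 0 - mle R (X^~ w) 0|, 0.
move=> _ [i _ <-].
apply: le_trans (typical_deviation hn (distribution_in01 i hp) L1 (typ i)) _.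
have c0 : 0 <= b * Num.sqrt a by rewrite mulr_ge0.
rewrite b2 bE; move: c0; rewrite bE; lra.
Qed.
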